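(* Let $K\subset\mathbb R^m$ be a closed convex cone and let $C\subset\mathbb R^m$ be a nonempty closed convex set. Then $C$ is $K$-invariant if and only if the metric projection $P_C$ is $K$-isotone.
   Context: $\mathbb R^m$ carries the standard inner product $\langle\cdot,\cdot\rangle$. A convex cone is a nonempty set $K\subset\mathbb R^m$ with $K+K\subset K$ and $tK\subset K$ for all $t\ge 0$. Its dual is $K^*=\{y\in\mathbb R^m:\langle x,y\rangle\ge 0\ \forall x\in K\}$. The relation $\le$ is defined by $x\le y\iff y-x\in K$ (reflexive and transitive, not necessarily antisymmetric). For a nonempty closed convex set $D$, $P_D$ denotes the metric projection onto $D$: $P_Dx$ is the unique nearest point of $D$ to $x$. Lattice-like operations: for $x,y\in\mathbb R^m$, $x\sqcap y=P_{x-K}y$, $x\sqcup y=P_{x+K}y$, $x\sqcap_* y=P_{x-K^*}y$, $x\sqcup_* y=P_{x+K^*}y$. A set $M\subset\mathbb R^m$ is invariant with respect to one of these operations if applying the operation to any $x,y\in M$ gives an element of $M$. $M$ is $K$-invariant if it is invariant with respect to all four operations $\sqcap,\sqcup,\sqcap_*,\sqcup_*$. $P_C$ is $K$-isotone if $x\le y$ implies $P_Cx\le P_Cy$ for all $x,y\in\mathbb R^m$. *)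

(* Defs.v *)
From HB Require Import structures.
From mathcomp Require Import all_boot all_order all_algebra.
From mathcomp Require Import all_classical all_reals all_analysis.

Set Implicit Arguments.
Unset Strict Implicit.
Unset Printing Implicit Defensive.

Import Order.TTheory GRing.Theory Num.Theory.
Import numFieldNormedType.Exports.

Local Open Scope classical_set_scope.
Local Open Scope ring_scope.

Definition dotv (R : realType) (m : nat) (x y : 'rV[R]_m) : R :=
  \sum_(i < m) x 0 i * y 0 i.

(* The library norm `|x| on 'rV[R]_m is the sup norm; it induces the same
   topology as enorm, but its nearest points are not the metric projection. *)
Definition enorm (R : realType) (m : nat) (x : 'rV[R]_m) : R :=
  Num.sqrt (dotv x x).

Definition convex_cone (R : realType) (m : nat) (K : set 'rV[R]_m) : Prop :=
  [/\ K !=set0,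
      forall x y, K x -> K y -> K (x + y) &
      forall (t : R) x, 0 <= t -> K x -> K (t *: x)].

Definition dual_cone (R : realType) (m : nat) (K : set 'rV[R]_m) :
    set 'rV[R]_m :=
  [set y | forall x, K x -> 0 <= dotv x y].

Definition cone_le (R : realType) (m : nat) (K : set 'rV[R]_m)
    (x y : 'rV[R]_m) : Prop :=
  K (y - x).

Definition nearest_point (R : realType) (m : nat) (D : set 'rV[R]_m)
    (x p : 'rV[R]_m) : Prop :=
  D p /\ forall q, D q -> enorm (x - p) <= enorm (x - q).

(* For D nonempty, closed and convex the nearest point exists and is unique;
   the default value 0 is returned only when no nearest point exists. *)
Definition metric_proj (R : realType) (m : nat) (D : set 'rV[R]_m)
    (x : 'rV[R]_m) : 'rV[R]_m :=
  xget 0 [set p | nearest_point D x p].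

(* The operations x sqcap_* y and x sqcup_* y attached to the dual cone are
   cone_meet (dual_cone K) x y and cone_join (dual_cone K) x y. *)
Definition cone_meet (R : realType) (m : nat) (K : set 'rV[R]_m)
    (x y : 'rV[R]_m) : 'rV[R]_m :=
  metric_proj [set x - k | k in K] y.

Definition cone_join (R : realType) (m : nat) (K : set 'rV[R]_m)
    (x y : 'rV[R]_m) : 'rV[R]_m :=
  metric_proj [set x + k | k in K] y.

Definition invariant_under (R : realType) (m : nat)
    (op : 'rV[R]_m -> 'rV[R]_m -> 'rV[R]_m) (M : set 'rV[R]_m) : Prop :=
  forall x y, M x -> M y -> M (op x y).

Definition cone_invariant (R : realType) (m : nat) (K M : set 'rV[R]_m) :
    Prop :=
  [/\ invariant_under (cone_meet K) M,
      invariant_under (cone_join K) M,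
      invariant_under (cone_meet (dual_cone K)) M &
      invariant_under (cone_join (dual_cone K)) M].

Definition cone_isotone (R : realType) (m : nat) (K : set 'rV[R]_m)
    (f : 'rV[R]_m -> 'rV[R]_m) : Prop :=
  forall x y, cone_le K x y -> cone_le K (f x) (f y).

(* Main.v *)
(* By Moreau's decomposition, y - x = k - s with k in K, s in K^* and
   <k, s> = 0; then the join of x and y for K is x + k = y + s, which is also
   the dual join of y and x, and the meet of y and x for K is y - k = x - s,
   the dual meet of x and y. So invariance amounts to C containing x + k and
   y - k for all x, y in C.
   If C is invariant and x <= y, decompose P y - P x = k - s: the variational
   inequalities of P x and P y tested at P y - k = P x - s and P x + k = P y + s
   add up to |s|^2 <= 0. Conversely, if P is isotone and z = x + k, then x <= z
   gives x <= P z, and the variational inequality of P z tested at y = z - s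
   gives |z - P z|^2 <= 0, so z lies in C; the meet is symmetric. *)
Require Import Defs.
From mathcomp Require Import all_boot all_order all_algebra.
From mathcomp Require Import all_classical all_reals all_analysis.
From mathcomp Require Import ring lra.

Import Order.TTheory GRing.Theory Num.Theory.
Import numFieldNormedType.Exports.

Local Open Scope classical_set_scope.
Local Open Scope ring_scope.

(** * Euclidean inner product on row vectors *)

Section InnerProduct.
Context {R : realType} {m : nat}.
Implicit Types x y z : 'rV[R]_m.

Lemma dotvC x y : dotv x y = dotv y x.
Proof. by apply: eq_bigr => i _; rewrite mulrC. Qed.

Lemma dotvDr x y z : dotv x (y + z) = dotv x y + dotv x z.
Proof. by rewrite -big_split; apply: eq_bigr => i _; rewrite mxE mulrDr. Qed.

Lemma dotvZr (a : R) x y : dotv x (a *: y) = a * dotv x y.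
Proof.
by rewrite /dotv big_distrr; apply: eq_bigr => i _; rewrite mxE mulrCA.
Qed.

Lemma dotvNr x y : dotv x (- y) = - dotv x y.
Proof. by rewrite -scaleN1r dotvZr mulN1r. Qed.

Lemma dotvDl x y z : dotv (x + y) z = dotv x z + dotv y z.
Proof. by rewrite !(dotvC _ z) dotvDr. Qed.

Lemma dotvZl (a : R) x y : dotv (a *: x) y = a * dotv x y.
Proof. by rewrite !(dotvC _ y) dotvZr. Qed.

Lemma dotvNl x y : dotv (- x) y = - dotv x y.
Proof. by rewrite !(dotvC _ y) dotvNr. Qed.

Definition dotvE := (dotvDl, dotvDr, dotvNl, dotvNr, dotvZl, dotvZr).

Lemma dotvv_ge0 x : 0 <= dotv x x.
Proof. by apply: sumr_ge0 => i _; rewrite -expr2 sqr_ge0. Qed.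

Lemma sqr_coord_le_dotv x i : x 0 i ^+ 2 <= dotv x x.
Proof.
rewrite /dotv (bigD1 i) //= expr2 lerDl.
by apply: sumr_ge0 => j _; rewrite -expr2 sqr_ge0.
Qed.

Lemma dotvv_le0 x : dotv x x <= 0 -> x = 0.
Proof.
move=> x_le0; apply/rowP => i; rewrite mxE; apply/eqP; rewrite -sqrf_eq0.
by rewrite eq_le sqr_ge0 (le_trans (sqr_coord_le_dotv x i)).
Qed.

Lemma continuous_dotv_sub x :
  continuous (fun y : 'rV[R]_m => dotv (x - y) (x - y)).
Proof.
have coord i : continuous (fun y : 'rV[R]_m => (x - y) 0 i * (x - y) 0 i).
  move=> y; have cvgi : (x - z) 0 i @[z --> y] --> (x - y) 0 i.
    rewrite !mxE; under eq_fun do rewrite !mxE.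
    exact: (cvgB (cvg_cst _) (@coord_continuous R 1 m 0 i y)).
  exact: (cvgM cvgi cvgi).
have addC : continuous (fun z : R * R => z.1 + z.2).
  by move=> z; apply: cvgD; [exact: cvg_fst | exact: cvg_snd].
exact: (continuous_big addC (fun i _ => coord i)).
Qed.

End InnerProduct.

Ltac row_ring := apply/rowP => ?; rewrite !mxE; ring.

(** * Existence and variational characterization of nearest points *)

Section MetricProjection.
Set Implicit Arguments.
Unset Strict Implicit.
Context {R : realType} {m : nat}.
Implicit Types (D : set 'rV[R]_m) (x y p q : 'rV[R]_m).

Lemma le_enorm x y : (enorm x <= enorm y) = (dotv x x <= dotv y y).
Proof. by rewrite /enorm ler_sqrt // dotvv_ge0. Qed.

Lemma convex_setP D : convex_set D <->
  forall x y (t : R), 0 <= t -> t <= 1 -> D x -> D y -> D (t *: x + (1 - t) *: y).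
Proof.
split=> [convD x y t t0 t1 Dx Dy|convD x y t].
  exact/set_mem/(convD x y (Itv01 t0 t1) (mem_set Dx) (mem_set Dy)).
by move=> /set_mem Dx /set_mem Dy; apply/mem_set/convD.
Qed.

(** Any point of [D] at least as close to [x] as [d] lies in the cube [B], since each coordinate of
    a difference is at most its Euclidean norm. The squared distance attains its minimum on the
    compact set [B] and [D] share, and points outside [B] are farther than [d]. *)
Lemma nearest_point_exists D x :
  closed D -> D !=set0 -> exists p, nearest_point D x p.
Proof.
move=> closedD [d Dd]; pose r := enorm (x - d).
pose B := [set v : 'rV[R]_m | forall i, `[x 0 i - r, x 0 i + r]%classic (v 0 i)].
have compB : compact (B `&` D).
  apply: compact_closedI closedD.
  apply: (@rV_compact R m (fun i => `[x 0 i - r, x 0 i + r]%classic)) => i.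
  exact: segment_compact.
have inB q : dotv (x - q) (x - q) <= dotv (x - d) (x - d) -> B q.
  move=> le_qd i /=; rewrite in_itv /=.
  have : `|(x - q) 0 i| <= r.
    rewrite -sqrtr_sqr ler_sqrt ?dotvv_ge0 //.
    exact: le_trans (sqr_coord_le_dotv _ i) le_qd.
  by rewrite ler_norml !mxE => /andP[]; lra.
have BDd : (B `&` D) d by split=> //; exact: inB.
have [] := @EVT_min_rV _ _ (fun q => dotv (x - q) (x - q)) _
  (ex_intro _ d BDd) compB.
  by apply: continuous_subspaceT; exact: continuous_dotv_sub.
move=> p /set_mem[_ Dp] pmin; exists p; split=> // q Dq; rewrite le_enorm.
have [/inB Bq|/ltW] := leP (dotv (x - q) (x - q)) (dotv (x - d) (x - d)).
  by apply: pmin; apply/mem_set.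
by apply: le_trans; apply: pmin; apply/mem_set.
Qed.

(** The obtuse-angle criterion for [p] to be the projection of [x]. *)
Definition variational D x p :=
  D p /\ forall q, D q -> dotv (x - p) (q - p) <= 0.

Lemma nearest_point_variational D x p :
  convex_set D -> nearest_point D x p -> variational D x p.
Proof.
move=> /convex_setP convD [Dp pmin]; split=> // q Dq.
set a := dotv (x - p) (q - p); set b := dotv (q - p) (q - p).
rewrite leNgt; apply/negP => a_gt0.
have b_ge0 : 0 <= b := dotvv_ge0 _.
have ab_gt0 : 0 < a + b by lra.
(* Moving from p to p + t (q - p) changes the squared distance to x by
   t (t b - 2 a), which is negative for this t. *)
pose t := a / (a + b).
have t_gt0 : 0 < t by rewrite divr_gt0.
have t_le1 : t <= 1 by rewrite ler_pdivrMr // mul1r lerDl.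
have tE : t * (a + b) = a by rewrite divfK // gt_eqF.
have := pmin _ (convD _ _ _ (ltW t_gt0) t_le1 Dq Dp).
have -> : t *: q + (1 - t) *: p = p + t *: (q - p).
  by rewrite scalerBl scale1r scalerBr addrCA.
rewrite le_enorm opprD addrA.
rewrite !(dotvDl (x - p)) !(dotvDr _ (x - p)) !dotvNl !dotvNr !dotvZl !dotvZr.
rewrite (dotvC (q - p) (x - p)) -/a -/b; nra.
Qed.

(** Expanding the square gives |x - q|^2 >= |x - p|^2 + |q - p|^2 for [q] in [D], which yields both
    minimality of [p] and uniqueness. *)
Lemma metric_proj_variational D x p : variational D x p -> metric_proj D x = p.
Proof.
move=> [Dp var].
have sqE q : dotv (x - q) (x - q) =
    dotv (x - p) (x - p) + dotv (q - p) (q - p) - 2 * dotv (x - p) (q - p).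
  have -> : x - q = (x - p) - (q - p) by rewrite opprB addrA subrK.
  rewrite !(dotvDl (x - p)) !(dotvDr _ (x - p)) !dotvNl !dotvNr.
  by rewrite (dotvC (q - p) (x - p)); ring.
apply: xget_unique => [|q [Dq qmin]].
  split=> // q Dq; rewrite le_enorm (sqE q).
  by have := var _ Dq; have := dotvv_ge0 (q - p); lra.
apply/eqP; rewrite -subr_eq0; apply/eqP/dotvv_le0.
by have := qmin _ Dp; rewrite le_enorm (sqE q); have := var _ Dq; lra.
Qed.

Lemma metric_projP D x : closed D -> convex_set D -> D !=set0 ->
  variational D x (metric_proj D x).
Proof.
move=> closedD convD D0.
have [p /(nearest_point_variational convD) var] := nearest_point_exists x closedD D0.
by rewrite (metric_proj_variational var).
Qed.

End MetricProjection.

(** * Moreau decompositions and the lattice-like operations *)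

Section Cones.
Set Implicit Arguments.
Unset Strict Implicit.
Context {R : realType} {m : nat}.
Implicit Types (A B C K : set 'rV[R]_m) (x y u k s : 'rV[R]_m).

(* Moreau's decomposition of u when B is the dual cone of A, or vice versa. *)
Definition moreau A B u k s := [/\ u = k - s, A k, B s & dotv k s = 0].

(** Take [k] the projection of [u] onto [K] and [s = k - u]. Testing the variational inequality at
    [k + x] puts [s] in the dual cone; testing at [k + k] and at 0 gives orthogonality. *)
Lemma moreau_exists K u : convex_cone K -> closed K ->
  exists k s, moreau K (dual_cone K) u k s.
Proof.
move=> [K0 KD KZ] closedK.
have convK : convex_set K.
  apply/convex_setP => x y t t0 t1 Kx Ky.
  by apply: KD; apply: KZ => //; rewrite subr_ge0.
have [Kk var] := metric_projP u closedK convK K0.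
set k := metric_proj K u in Kk var.
exists k, (k - u).
have le0 x : K x -> dotv (u - k) x <= 0.
  by move=> Kx; have := var _ (KD _ _ Kk Kx); rewrite [k + x]addrC addrK.
split=> //; first by rewrite subKr.
  by move=> x /le0; rewrite !dotvE !(dotvC x); lra.
have : dotv (u - k) k <= 0 := le0 _ Kk.
have := var _ (KZ 0 _ (lexx _) Kk); rewrite scale0r sub0r.
by rewrite !dotvE (dotvC k u); lra.
Qed.

Section Polar.
Context {A B : set 'rV[R]_m} (polarAB : forall a b, A a -> B b -> 0 <= dotv a b).

(** The variational inequality at [x + a] reduces to <a, s> >= 0. Keeping [A] and [B] abstract
    serves both the pair [K], [dual_cone K] and the swapped pair. *)
Lemma cone_join_moreau x u k s : moreau A B u k s -> cone_join A x (x + u) = x + k.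
Proof.
move=> [-> Ak Bs ks0]; apply: metric_proj_variational.
split=> [|_ [a Aa <-]]; first by exists k.
have -> : x + (k - s) - (x + k) = - s by row_ring.
have -> : x + a - (x + k) = a - k by row_ring.
by have := polarAB Aa Bs; rewrite !dotvE !(dotvC s) ks0; lra.
Qed.

Lemma cone_meet_moreau x u k s : moreau A B u k s -> cone_meet A x (x - u) = x - k.
Proof.
move=> [-> Ak Bs ks0]; apply: metric_proj_variational.
split=> [|_ [a Aa <-]]; first by exists k.
have -> : x - (k - s) - (x - k) = s by row_ring.
have -> : x - a - (x - k) = k - a by row_ring.
by have := polarAB Aa Bs; rewrite !dotvE !(dotvC s) ks0; lra.
Qed.

End Polar.

Lemma dual_cone_polar K a b : K a -> dual_cone K b -> 0 <= dotv a b.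
Proof. by move=> Ka; exact. Qed.

Lemma dual_cone_polarC K a b : dual_cone K a -> K b -> 0 <= dotv a b.
Proof. by rewrite dotvC; move=> /[swap]; exact: dual_cone_polar. Qed.

(** Lets the dual operations reuse a decomposition taken with respect to [K]. *)
Lemma moreauN A B u k s : moreau A B u k s -> moreau B A (- u) s k.
Proof. by move=> [-> Ak Bs ks0]; split; rewrite ?opprB // dotvC. Qed.

Lemma isotone_moreau K C x y k s :
  closed C -> convex_set C -> cone_isotone K (metric_proj C) ->
  C x -> C y -> moreau K (dual_cone K) (y - x) k s -> C (x + k) /\ C (y - k).
Proof.
move=> closedC convC iso Cx Cy [yxE Kk Ks ks0].
have C0 : C !=set0 by exists x.
have proj_id z : C z -> metric_proj C z = z.
  move=> Cz; apply: metric_proj_variational.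
  by split=> // q _; rewrite subrr -(scale0r 0) dotvZl mul0r.
have yE : y = x + k - s by rewrite -addrA -yxE addrC subrK.
split.
- set z := x + k; set w := metric_proj C z.
  have [Cw var] := metric_projP z closedC convC C0; rewrite -/w in Cw var.
  have Kw : K (w - x).
    by rewrite -(proj_id _ Cx); apply: iso; rewrite /cone_le /z [x + k]addrC addrK.
  suff -> : z = w by [].
  apply/eqP; rewrite -subr_eq0; apply/eqP/dotvv_le0.
  (* As <k, s> = 0, this pairing is -<w - x, s>. The test at [y] then bounds |z - w|^2 by it. *)
  have : dotv (z - w) s <= 0.
    have -> : z - w = k - (w - x) by rewrite /z; row_ring.
    by rewrite dotvDl dotvNl ks0; have := Ks _ Kw; lra.
  have := var _ Cy; have -> : y - w = (z - w) - s by rewrite /z yE; row_ring.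
  by rewrite dotvDr dotvNr; lra.
- set z := y - k; set w := metric_proj C z.
  have [Cw var] := metric_projP z closedC convC C0; rewrite -/w in Cw var.
  have Kw : K (y - w).
    by rewrite -(proj_id _ Cy); apply: iso; rewrite /cone_le /z subKr.
  suff -> : z = w by [].
  apply/eqP; rewrite -subr_eq0; apply/eqP/dotvv_le0.
  have : 0 <= dotv (z - w) s.
    have -> : z - w = (y - w) - k by rewrite /z; row_ring.
    by rewrite dotvDl dotvNl ks0; have := Ks _ Kw; lra.
  have := var _ Cx; have -> : x - w = (z - w) + s by rewrite /z yE; row_ring.
  by rewrite dotvDr; lra.
Qed.

End Cones.

Theorem theorem1 (R : realType) (m : nat) (K C : set 'rV[R]_m)
    (coneK : convex_cone K) (closedK : closed K)
    (C0 : C !=set0) (closedC : closed C) (convexC : convex_set C) :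
  cone_invariant K C <-> cone_isotone K (metric_proj C).
Proof.
split=> [[Cmeet Cjoin _ _] x y Kxy | iso].
- have [Cp varp] := metric_projP x closedC convexC C0.
  have [Cq varq] := metric_projP y closedC convexC C0.
  set p := metric_proj C x in Cp varp *; set q := metric_proj C y in Cq varq *.
  have [k [s mks]] := moreau_exists (q - p) coneK closedK.
  have := Cjoin _ _ Cp Cq; have := Cmeet _ _ Cq Cp.
  have := cone_meet_moreau (@dual_cone_polar _ _ K) q mks.
  have := cone_join_moreau (@dual_cone_polar _ _ K) p mks.
  rewrite subKr addrCA subrr addr0 => -> -> Cqk Cpk.
  have [qpE Kk Ks ks0] := mks.
  suff s0 : s = 0 by rewrite /cone_le qpE s0 subr0.
  apply: dotvv_le0.
  have := varp _ Cqk; have -> : q - k - p = - s.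
    by rewrite addrAC qpE addrAC subrr sub0r.
  have := varq _ Cpk; have -> : p + k - q = s.
    by rewrite addrAC -opprB qpE opprB subrK.
  (* Pairing [y - q] with [s] gives <y - x, s> + <x - p, s> + |s|^2. The first two terms are
     nonnegative and the total is at most 0. *)
  have := Ks _ Kxy.
  have -> : y - q = (y - x) + (x - p) - (q - p).
    by rewrite subrKA opprB subrKA.
  by rewrite qpE !dotvDl !dotvNl !dotvDl !dotvNr !dotvNl ks0; lra.
- have key x y : C x -> C y -> exists k s,
    [/\ moreau K (dual_cone K) (y - x) k s, C (x + k) & C (y - k)].
    move=> Cx Cy; have [k [s mks]] := moreau_exists (y - x) coneK closedK.
    by exists k, s; have [] := isotone_moreau closedC convexC iso Cx Cy mks.
  have addB x y : x + (y - x) = y :> 'rV[R]_m by rewrite addrC subrK.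
  split=> x y Cx Cy.
  (* The arguments are swapped because the meet subtracts: [y] is [x - u] with [u = x - y]. *)
  + have [k [s [mks _ Cxk]]] := key _ _ Cy Cx.
    by have := cone_meet_moreau (@dual_cone_polar _ _ K) x mks; rewrite subKr => ->.
  + have [k [s [mks Cxk _]]] := key _ _ Cx Cy.
    by have := cone_join_moreau (@dual_cone_polar _ _ K) x mks; rewrite addB => ->.
  (* The dual meet is [x - s], which equals [y - k] because [y - x = k - s]; the dual join is
     handled likewise. *)
  + have [k [s [mks _ Cyk]]] := key _ _ Cx Cy.
    have := cone_meet_moreau (@dual_cone_polarC _ _ K) x (moreauN mks).
    rewrite opprK addB => ->.
    have [yxE _ _ _] := mks.
    by rewrite (_ : x - s = y - k) // -[y](addB x) yxE addrA addrAC addrK.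
  + have [k [s [mks Cyk _]]] := key _ _ Cy Cx.
    have := cone_join_moreau (@dual_cone_polarC _ _ K) x (moreauN mks).
    rewrite opprB addB => ->.
    have [xyE _ _ _] := mks.
    by rewrite (_ : x + s = y + k) // -[x](addB y) xyE addrA subrK.
Qed.
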